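(* The set $\mathcal{Y}_F$ is exactly the set of balanced words in $\{0,1\}^{\mathbb{N}}$.
   Context: Let $\mathcal{A}=\{0,1\}$. For a finite word $v=v_1\cdots v_n$ over $\mathcal{A}$, $\tilde v=v_n\cdots v_1$ is its mirror word (with $\tilde\lambda=\lambda$ for the empty word). Let $F=\{0v01\tilde v1,\ 1\tilde v10v0 : v\in\mathcal{A}^*\}$, and let $\mathcal{Y}_F$ be the set of right-infinite words $\mathbf{y}\in\mathcal{A}^{\mathbb{N}}$ none of whose finite factors belongs to $F$. A (finite or infinite) word $\mathbf{x}$ is balanced if $\bigl||u|_1-|v|_1\bigr|\le1$ for all factors $u,v$ of $\mathbf{x}$ with $|u|=|v|$, where $|u|$ is the length of $u$ and $|u|_1$ the number of occurrences of $1$ in $u$. *)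

(* Defs.v *)
From HB Require Import structures.
From mathcomp Require Import all_boot all_order all_algebra.
From mathcomp Require Import boolp classical_sets.

Set Implicit Arguments.
Unset Strict Implicit.
Unset Printing Implicit Defensive.

Local Open Scope classical_set_scope.

(* The alphabet {0, 1} is [bool], with [false] for 0 and [true] for 1. *)
Definition word := seq bool.
Definition infinite_word := nat -> bool.

Definition factors (y : infinite_word) : set word :=
  [set u | exists i, u = mkseq (fun k => y (i + k)) (size u)].

Definition F : set word :=
  [set w | exists v : word,
     w = [:: false] ++ v ++ [:: false; true] ++ rev v ++ [:: true] \/
     w = [:: true] ++ rev v ++ [:: true; false] ++ v ++ [:: false]].

Definition Y (X : set word) : set infinite_word :=
  [set y | forall u, factors y u -> ~ X u].

Definition balanced (y : infinite_word) : Prop :=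
  forall u v : word, factors y u -> factors y v -> size u = size v ->
    (`|(count_mem true u)%:Z - (count_mem true v)%:Z| <= 1)%R.

(* Main.v *)
(** A word [0 v 01 rev v 1] contains both [0 v 0] and [1 (rev v) 1], whose numbers of
    ones differ by 2, so balanced words avoid [F].

    Conversely, an unbalanced [y] has, for a minimal [n], factors [x w x] at [i] and
    [x' w x'] at [j] with [x <> x'] and [|w| = n]; swapping the letters, take [i < j].
    Suppose there is no such pair at a smaller distance.
    Minimality of [n] makes [w] a palindrome, keeps the two occurrences disjoint, and
    puts [x] just before the second one.  Now read [y] outwards from the centre [x x']
    at positions [j - 1, j].  As [y] avoids [F], the first disagreement between the left
    and right readings, if any, has [x'] on the left and [x] on the right.  Together
    with the minimality of [n], it yields either [x' w x'] strictly between [i] and [j],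
    or [x w x] to the right of [j] at a distance smaller than [j - i]; without any
    disagreement, the mirror image of [x w x] gives the latter.  Hence infinite descent
    on the distance. *)
Require Import Defs.
From mathcomp Require Import all_boot all_order all_algebra.
From mathcomp Require Import boolp classical_sets.
From mathcomp Require Import zify.

Local Open Scope classical_set_scope.

(** * Windows of an infinite word *)

Definition window (y : infinite_word) (i k : nat) : word :=
  mkseq (fun t => y (i + t)) k.

Lemma size_window y i k : size (window y i k) = k.
Proof. exact: size_mkseq. Qed.

Lemma factor_window y i k : factors y (window y i k).
Proof. by exists i; rewrite size_window. Qed.

Lemma windowD y i k l : window y i (k + l) = window y i k ++ window y (i + k) l.
Proof.
rewrite /window /mkseq iotaD map_cat add0n; congr (_ ++ _).
rewrite -[X in iota X]addn0 iotaDl -map_comp.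
by apply: eq_map => t /=; rewrite addnA.
Qed.

Lemma window1 y i : window y i 1 = [:: y i].
Proof. by rewrite /window /mkseq /= addn0. Qed.

Lemma windowS y i k : window y i k.+1 = y i :: window y i.+1 k.
Proof. by rewrite -add1n windowD window1 addn1. Qed.

Lemma eq_window y i j k : (forall r, r < k -> y (i + r) = y (j + r)) ->
  window y i k = window y j k.
Proof.
move=> e; apply: (@eq_from_nth _ false); rewrite !size_window // => r rk.
by rewrite !nth_mkseq // e.
Qed.

Lemma rev_window y i j k : (forall r, r < k -> y (i + r) = y (j + (k - r.+1))) ->
  rev (window y j k) = window y i k.
Proof.
move=> e; apply: (@eq_from_nth _ false); rewrite size_rev !size_window // => r rk.
rewrite nth_rev size_window // !nth_mkseq ?e //; lia.
Qed.

Lemma factors_infix y p s q : factors y (p ++ s ++ q) -> factors y s.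
Proof.
case=> i; rewrite -/(window y i _) !size_cat !windowD => /eqP.
rewrite eqseq_cat ?size_window // => /andP[_].
rewrite eqseq_cat ?size_window // => /andP[/eqP e _].
by exists (i + size p).
Qed.

(** * Factors in [F] *)

Lemma balanced_Y y : balanced y -> Y F y.
Proof.
move=> bal u uy [v [e|e]]; move: uy; rewrite {}e => uy.
- have f0 : factors y ([:: false] ++ v ++ [:: false]).
    by apply: (@factors_infix y [::] _ ([:: true] ++ rev v ++ [:: true]));
       rewrite -!catA.
  have f1 : factors y ([:: true] ++ rev v ++ [:: true]).
    apply: (@factors_infix y ([:: false] ++ v ++ [:: false]) _ [::]).
    by rewrite cats0 -!catA.
  have := bal _ _ f0 f1; rewrite !size_cat size_rev => /(_ erefl).
  rewrite !count_cat count_rev /=; lia.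
- have f0 : factors y ([:: false] ++ v ++ [:: false]).
    apply: (@factors_infix y ([:: true] ++ rev v ++ [:: true]) _ [::]).
    by rewrite cats0 -!catA.
  have f1 : factors y ([:: true] ++ rev v ++ [:: true]).
    by apply: (@factors_infix y [::] _ ([:: false] ++ v ++ [:: false]));
       rewrite -!catA.
  have := bal _ _ f0 f1; rewrite !size_cat size_rev => /(_ erefl).
  rewrite !count_cat count_rev /=; lia.
Qed.

(** Otherwise the window reads [a u a b (rev u) b] with [a <> b], an element of [F]. *)
Lemma Y_centered y c k : Y F y -> k < c -> y c <> y c.+1 ->
  (forall r, r < k -> y (c - r.+1) = y (c.+2 + r)) ->
  y (c - k.+1) = y c -> y (c.+2 + k) <> y c.+1.
Proof.
move=> yF kc ne pal e1 e2.
apply: (yF _ (factor_window y (c - k.+1) (1 + (k + (2 + (k + 1)))))).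
have rw : rev (window y (c - k) k) = window y c.+2 k.
  apply: rev_window => r rk; rewrite -pal //; congr y; lia.
have rw' : rev (window y c.+2 k) = window y (c - k) k.
  by rewrite -rw revK.
rewrite !windowD !windowS /= e1.
have -> : c - k.+1 + 1 = c - k by lia.
have -> : c - k + k = c by lia.
rewrite addn2 e2 /window /=.
case yc : (y c) ne => ne; case yc1 : (y c.+1) ne => // _.
- by exists (window y c.+2 k); right; rewrite rw'.
- by exists (window y (c - k) k); left; rewrite rw.
Qed.

(* Occurrences of [a w a] at [i] and [b w b] at [j], with [a <> b] and [n] the length of [w]. *)
Definition unbalanced_pair (y : infinite_word) (n i j : nat) : Prop :=
  [/\ y i <> y j, y (i + n.+1) = y i, y (j + n.+1) = y j &
      forall r, r < n -> y (i.+1 + r) = y (j.+1 + r)].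

(* [lia] case-splits on every boolean equation in the context. *)
Ltac arith :=
  intros;
  lazymatch goal with |- @eq bool _ _ => fail | _ => idtac end;
  repeat match goal with
  | H : @eq bool _ _ |- _ => clear H
  | H : ~ @eq bool _ _ |- _ => clear H
  end; lia.

(** * Descent on the distance in a shortest unbalanced pair *)

Section Descent.

Variables (y : infinite_word) (n : nat).
Hypothesis yF : Y F y.
Hypothesis short_balanced : forall a b k, k < n.+2 ->
  count_mem true (window y a k) <= (count_mem true (window y b k)).+1.

(** Adding the end letters turns equal counts into a difference of 2 at length [k.+2 < n.+2]. *)
Lemma no_short_pair a b k a' b' x : k < n ->
    a' = a + k.+1 -> b' = b + k.+1 ->
    y a = x -> y a' = x -> y b = ~~ x -> y b' = ~~ x ->
  count_mem true (window y a.+1 k) <> count_mem true (window y b.+1 k).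
Proof.
move=> kn -> -> ya ya' yb yb' e.
have := short_balanced a b k.+2 kn; have := short_balanced b a k.+2 kn.
rewrite -[k.+2]addn1 !windowD !window1 !windowS !count_cat /= e ya ya' yb yb'.
case: (x) => /=; lia.
Qed.

Lemma no_short a b k a' b' x : k < n ->
    a' = a + k.+1 -> b' = b + k.+1 ->
    y a = x -> y a' = x -> y b = ~~ x -> y b' = ~~ x ->
  ~ forall r, r < k -> y (a.+1 + r) = y (b.+1 + r).
Proof.
move=> kn ea eb ya ya' yb yb' e.
by apply: (no_short_pair _ _ _ _ _ _ kn ea eb ya ya' yb yb'); rewrite (eq_window _ _ _ _ e).
Qed.

Lemma no_short_rev a b k a' b' x : k < n ->
    a' = a + k.+1 -> b' = b + k.+1 ->
    y a = x -> y a' = x -> y b = ~~ x -> y b' = ~~ x ->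
  ~ forall r, r < k -> y (a.+1 + r) = y (b.+1 + (k - r.+1)).
Proof.
move=> kn ea eb ya ya' yb yb' e.
apply: (no_short_pair _ _ _ _ _ _ kn ea eb ya ya' yb yb').
by rewrite -(rev_window _ _ _ _ e) count_rev.
Qed.

Lemma neqb_cases (x b c : bool) : b <> c ->
  (b = x /\ c = ~~ x) \/ (b = ~~ x /\ c = x).
Proof. by case: x b c => [] [] []; tauto. Qed.

Section Pair.

Variables (x : bool) (i j : nat).
Hypotheses (lt_ij : i < j) (yi : y i = x) (yi' : y (i + n.+1) = x)
  (yj : y j = ~~ x) (yj' : y (j + n.+1) = ~~ x).
Hypothesis wij : forall r, r < n -> y (i.+1 + r) = y (j.+1 + r).

Lemma pair_disjoint : i + n.+2 <= j.
Proof.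
rewrite leqNgt; apply/negP => lt_j.
have [d_n1|d_n1] := eqVneq j (i + n.+1); first by move: yj yi'; rewrite d_n1 => ->; case: x.
pose d := j - i.
have yP r : i < r -> r <= i + n -> y r = y (r + d).
  move=> ir rin; have -> : r = i.+1 + (r - i.+1) by arith.
  rewrite wij; last arith.
  congr y; rewrite /d; arith.
(* On an overlap, [yP] gives the period [d]; dropping the last [d] letters of the first occurrence
   and the first [d] of the second leaves a shorter pair. *)
apply: (@no_short i (j + d) (n - d) (i + n.+1 - d) (j + n.+1) x) => //; try (rewrite /d; arith).
- rewrite yP; try (rewrite /d; arith). rewrite -[RHS]yi'; congr y; rewrite /d; arith.
- rewrite -yj -yP //; rewrite /d; arith.
- move=> r rk; rewrite wij; last by rewrite /d in rk *; arith.
  rewrite yP; rewrite /d in rk *; try arith. congr y; arith.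
Qed.

(** At the first mismatch, a prefix of one occurrence and a suffix of the other have opposite ends
    and mirror-image interiors, against minimality. *)
Lemma pair_palindrome t : t < n -> y (i.+1 + t) = y (i + (n - t)).
Proof.
elim/ltn_ind: t => t IH tn; case: (pselect (y (i.+1 + t) = y (i + (n - t)))) => //.
have yjt : y (j + (n - t)) = y (i + (n - t)).
  have -> : i + (n - t) = i.+1 + (n - t.+1) by arith.
  rewrite wij; last arith.
  congr y; arith.
case/(neqb_cases x) => -[e1 e2]; exfalso.
- apply: (@no_short_rev i (j + (n - t)) t (i.+1 + t) (j + n.+1) x) => //; try arith.
  + by rewrite yjt.
  + move=> r rt; rewrite IH //; last arith.
    have -> : i + (n - r) = i.+1 + (n - r.+1) by arith.
    rewrite wij; last arith.
    congr y; arith.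
- apply: (@no_short_rev (i + (n - t)) j t (i + n.+1) (j.+1 + t) x) => //; try arith.
  + by rewrite -wij.
  + move=> r rt; rewrite -wij; last arith.
    rewrite IH; try arith. congr y; arith.
Qed.

Hypothesis no_closer_left : forall j', i < j' -> j' < j -> ~ unbalanced_pair y n i j'.
Hypothesis no_closer_right : forall i', j < i' -> i' < j + (j - i) -> ~ unbalanced_pair y n j i'.

(** If [y j.-1] is [~~ x], minimality forces every letter of [w] to be [~~ x], so [~~ x w ~~ x]
    already occurs at [j.-1]. *)
Lemma pair_pred : y j.-1 = x.
Proof.
case: (pselect (y j.-1 = x)) => // /(neqb_cases x) [[-> _]|[yj1 _]] //; exfalso.
have lij := pair_disjoint.
have w1 t : t < n -> y (i.+1 + t) = ~~ x.
  elim/ltn_ind: t => t IH tn.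
  case: (pselect (y (i.+1 + t) = ~~ x)) => // /(neqb_cases x) [[yt _]|[]//].
  have yj1r r : r <= t -> y (j.-1.+1 + r) = ~~ x.
    case: r => [_|r rt]; first by rewrite addn0 prednK //; arith.
    rewrite prednK; last arith.
    rewrite addnS -addSn -wij; last arith.
    apply: IH; arith.
  exfalso; apply: (@no_short i j.-1 t (i.+1 + t) (j.-1.+1 + t) x) => //; try arith.
  + exact: yj1r.
  + move=> r rt; rewrite IH //; last arith. rewrite yj1r //; arith.
have wj1 t : t <= n -> y (j + t) = ~~ x.
  case: t => [_|t tn]; first by rewrite addn0.
  by rewrite addnS -addSn -wij // w1.
apply: (no_closer_left j.-1); try arith.
have e : j.-1.+1 = j by arith.
split; rewrite ?yi ?yj1 //; first by case: (x).
- by rewrite addnS -addSn e wj1.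
- by move=> r rn; rewrite w1 // e wj1 //; arith.
Qed.

(* The mirror reading around the centre [y j.-1, y j] cannot first fail inside [w]:
   the shift by [t.+2] would exhibit an earlier occurrence of [~~x w ~~x]. *)
Lemma no_deviation_inside t : t < n -> j - t.+2 > i ->
  (forall r, r < t -> y (j.-1 - r.+1) = y (j.+1 + r)) ->
  y (j.-1 - t.+1) = ~~ x -> y (j.+1 + t) <> x.
Proof.
move=> tn lt_i mir ut vt; have lij := pair_disjoint.
have wt : y (i.+1 + t) = x by rewrite wij.
have mirw r : r < t -> y ((j - t.+2).+1 + r) = y (i.+1 + (t - r.+1)).
  move=> rt; rewrite wij; last arith.
  rewrite -mir; last arith. congr y; arith.
have ub : y (j - t.+2) = ~~ x by rewrite -ut; congr y; arith.
have pal r : r < t -> y (i.+1 + r) = y (i.+1 + (t - r.+1)).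
  elim/ltn_ind: r => r IH rt.
  case: (pselect (y (i.+1 + r) = y (i.+1 + (t - r.+1)))) => // /(neqb_cases x) [] [e1 e2].
  - exfalso; apply: (@no_short i (j - t.+2) r (i.+1 + r) ((j - t.+2).+1 + r) x) => //; try arith.
    + by rewrite mirw.
    + by move=> s sr; rewrite mirw; [apply: IH|]; arith.
  - exfalso; apply: (@no_short_rev (i.+1 + (t - r.+1)) j r (i.+1 + t) (j.+1 + r) x) => //; try arith.
    + by rewrite -wij //; arith.
    + move=> s sr; rewrite -wij; last arith.
      rewrite IH; try arith. congr y; arith.
have shift s : s <= n.+1 -> y (j - t.+2 + s) = y (j + s).
  elim/ltn_ind: s => s IH sn.
  case: (pselect (y (j - t.+2 + s) = y (j + s))) => // ne; exfalso.
  have s0 : 0 < s by case: s {IH sn} ne => // ne; case: ne; rewrite !addn0 ub yj.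
  (* Smaller offsets agree by the mirror reading, the palindromic prefix of [w] and [pair_pred]. *)
  have st : t.+2 <= s.
    rewrite leqNgt; apply/negP => st; apply: ne.
    have [->|st'] := eqVneq s t.+1.
      have -> : j - t.+2 + t.+1 = j.-1 by arith.
      by rewrite pair_pred addnS -addSn vt.
    have -> : j - t.+2 + s = (j - t.+2).+1 + s.-1 by arith.
    rewrite mirw; last arith.
    rewrite -pal; last arith.
    rewrite wij; last arith.
    congr y; arith.
  case/(neqb_cases x): ne => -[e1 e2].
  - have st' : t.+2 < s.
      rewrite ltn_neqAle st andbT; apply/eqP => st'.
      by move: e1; rewrite -st' subnK ?yj; [case: (x)|arith].
    (* [IH] at [t.+2] puts [~~ x] at [j + t.+2], and the period [t.+2] copies a prefix of [w] after
       it. *)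
    apply: (@no_short i (j + t.+2) (s - t.+3) (i + (s - t.+2)) (j + s) x) => //; try arith.
    + have -> : i + (s - t.+2) = i.+1 + (s - t.+3) by arith.
      rewrite wij; last arith.
      rewrite -e1; congr y; arith.
    + rewrite -IH //; try arith. rewrite -yj; congr y; arith.
    + move=> r rk; rewrite wij; last arith.
      have -> : (j + t.+2).+1 + r = j + (t.+3 + r) by arith.
      rewrite -IH; try arith. congr y; arith.
  - have sn' : s <= n.
      rewrite leqNgt; apply/negP => ns; move: e2.
      have -> : s = n.+1 by arith.
      by rewrite yj'; case: (x).
    apply: (@no_short i (j - t.+2) s.-1 (i + s) (j - t.+2 + s) x) => //; try arith.
    + have -> : i + s = i.+1 + s.-1 by arith.
      rewrite wij; last arith.
      rewrite -e2; congr y; arith.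
    + move=> r rk; rewrite wij; last arith.
      have -> : (j - t.+2).+1 + r = j - t.+2 + r.+1 by arith.
      rewrite IH; try arith. congr y; arith.
apply: (no_closer_left (j - t.+2)); try arith.
split; rewrite ?yi ?ub //; first by case: (x).
- by rewrite shift.
- by move=> r rn; rewrite wij // !addSn -!addnS shift //; arith.
Qed.

(* Right special factors of each length at most [n] are unique, so a deviation
   beyond [w] happens just after an occurrence of [w]. *)
Lemma no_deviation_outside t : n < t -> j - t.+2 > i ->
  (forall r, r < t -> y (j.-1 - r.+1) = y (j.+1 + r)) ->
  y (j.-1 - t.+1) = ~~ x -> y (j.+1 + t) <> x.
Proof.
move=> nt lt_i mir ut vt; have lij := pair_disjoint.
have ub : y (j - t.+2) = ~~ x by rewrite -ut; congr y; arith.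
have ur r : r < t -> y ((j - t.+2).+1 + r) = y (j + (t - r)).
  move=> rt; have -> : j + (t - r) = j.+1 + (t - r.+1) by arith.
  rewrite -mir; last arith. congr y; arith.
have w s : s < n -> y (j + (t - s)) = y (i.+1 + s).
  elim/ltn_ind: s => s IH sn.
  case: (pselect (y (j + (t - s)) = y (i.+1 + s))) => // /(neqb_cases x) [] [e1 e2].
  - exfalso; apply: (@no_short_rev (j + (t - s)) j s (j.+1 + t) (j.+1 + s) x) => //; try arith.
    + by rewrite -wij.
    + move=> r rs; rewrite -wij; last arith.
      rewrite -IH; try arith. congr y; arith.
  - exfalso; apply: (@no_short i (j - t.+2) s (i.+1 + s) ((j - t.+2).+1 + s) x) => //; try arith.
    + by rewrite ur //; arith.
    + by move=> r rs; rewrite ur; [rewrite IH //|]; arith.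
(* The letter before the mirrored copy of [w] decides: [x] gives [x w x] there, while [~~ x]
   reflects to [~~ x w ~~ x] at [j - t.+2]. *)
case: (pselect (y (j + (t - n)) = x)) => [e|/(neqb_cases x)[[//]|[e _]]].
- apply: (no_closer_right (j + (t - n))); try arith.
  split; rewrite ?e ?yj //.
  + by case: (x).
  + rewrite -[RHS]vt; congr y; arith.
  + move=> r rn; rewrite -wij // pair_palindrome //.
    have -> : i + (n - r) = i.+1 + (n - r.+1) by arith.
    rewrite -w; last arith. congr y; arith.
- apply: (no_closer_left (j - t.+2)); try arith.
  split; rewrite ?yi ?ub //.
  + by case: (x).
  + rewrite addnS -addSn ur //.
  + move=> r rn; rewrite ur ?w //; arith.
Qed.

Lemma pair_absurd : False.
Proof.
have lij := pair_disjoint.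
(* The bound lets the left reading reach exactly [i]. *)
have mir t : t <= j - i.+2 -> y (j.-1 - t.+1) = y (j.+1 + t).
  elim/ltn_ind: t => t IH tT.
  case: (pselect (y (j.-1 - t.+1) = y (j.+1 + t))) => // /(neqb_cases x) [] [ut vt]; exfalso.
  - have e : j.-1.+1 = j by arith.
    apply: (@Y_centered y j.-1 t yF); rewrite ?e ?pair_pred ?yj ?ut ?vt //; try arith.
    + by move=> r rt; rewrite IH //; arith.
  - have lt_i : j - t.+2 > i.
      suff : j - t.+2 <> i by arith.
      move=> ei; move: ut; have -> : j.-1 - t.+1 = i by arith.
      by rewrite yi; case: (x).
    have mir r : r < t -> y (j.-1 - r.+1) = y (j.+1 + r).
      by move=> rt; apply: IH => //; arith.
    case: (ltngtP t n) => tn.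
    + exact: (no_deviation_inside t).
    + exact: (no_deviation_outside t).
    + by move: vt; rewrite tn addSn -addnS yj'; case: (x).
(* If the occurrences were adjacent, [i] would reflect to [j + n.+1], which carries the opposite
   letter. *)
have nT : n < j - i.+2.
  suff : j - i.+2 <> n by arith.
  move=> eT; have := mir n; rewrite -{1}eT leqnn => /(_ isT).
  have -> : j.-1 - n.+1 = i by arith.
  by rewrite yi addSn -addnS yj'; case: (x).
have mir' r : r <= j - i.+2 -> y (j.+1 + r) = y (i + (j - i.+2 - r)).
  by move=> rT; rewrite -mir //; congr y; arith.
(* The reflection of [i + n.+1], hence the start of the reflected [x w x]. *)
pose i' := j + (j - i.+2 - n).
have yi0 : y i' = x.
  have -> : i' = j.+1 + (j - i.+2 - n.+1) by rewrite /i'; arith.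
  rewrite mir'; last arith.
  rewrite -yi'; congr y; arith.
apply: (no_closer_right i'); try (rewrite /i'; arith).
split; rewrite ?yi0 ?yj //.
- by case: (x).
- have -> : i' + n.+1 = j.+1 + (j - i.+2) by rewrite /i'; arith.
  by rewrite mir' // subnn addn0.
- move=> r rn; rewrite -wij // pair_palindrome //.
  have -> : i'.+1 + r = j.+1 + (j - i.+2 - n + r) by rewrite /i'; arith.
  rewrite mir'; last arith.
  congr y; arith.
Qed.

End Pair.

(** A closer pair starting at [j] has the two letters exchanged, so the descent needs [x]
    arbitrary. *)
Lemma no_unbalanced_pair i j : i < j -> ~ unbalanced_pair y n i j.
Proof.
have [d] := ubnP (j - i); elim: d i j => // d IH i j dij lt_ij [ne yi yj w].
have nj : y j = ~~ y i by move: ne; case: (y i) (y j) => [] [].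
apply: (pair_absurd (y i) i j); rewrite // ?yj //.
- by move=> j' ij' j'j; apply: IH => //; arith.
- by move=> i' ji' i'd; apply: IH => //; arith.
Qed.

End Descent.

(** * Avoiding [F] implies balance *)

Lemma Y_window_balanced y : Y F y -> forall k a b,
  count_mem true (window y a k) <= (count_mem true (window y b k)).+1.
Proof.
move=> yF; elim/ltn_ind => k IH a b; rewrite leqNgt; apply/negP => imb.
(* A prefix and the remaining suffix each have excess at most 1, while the total is at least 2. *)
have D t : 0 < t < k ->
    count_mem true (window y a t) = (count_mem true (window y b t)).+1.
  move=> tk; have : k = t + (k - t) by lia.
  have l1 : t < k by lia.
  have l2 : k - t < k by lia.
  move=> ek; move: imb; rewrite ek !windowD !count_cat.
  have := IH _ l1 a b; have := IH _ l2 (a + t) (b + t); lia.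
have k2 : 1 < k.
  case: k {IH D} imb => [|[|//]] //; rewrite /window /=.
  by case: (y _); case: (y _).
have D1 t : 0 < t < k.-1 -> y (a + t) = y (b + t).
  move=> tk; have := D t.+1; rewrite -[t.+1]addn1 !windowD !window1 !count_cat D; last lia.
  move=> /(_ ltac:(lia)) /=; case: (y _); case: (y _) => /=; lia.
have [ya yb] : y a = true /\ y b = false.
  have := D 1 ltac:(lia); rewrite !window1 /=; case: (y _); case: (y _) => /=; lia.
have [ya' yb'] : y (a + k.-1) = true /\ y (b + k.-1) = false.
  move: imb; have {1 2}-> : k = k.-1 + 1 by lia.
  rewrite !windowD !window1 !count_cat D; last lia.
  rewrite /=; case: (y _); case: (y _) => /=; lia.
have bal c d l : l < k.-2.+2 ->
    count_mem true (window y c l) <= (count_mem true (window y d l)).+1.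
  by move=> lk; apply: IH; lia.
have ek : k.-2.+1 = k.-1 by lia.
case: (ltngtP a b) => ab.
- apply: (no_unbalanced_pair y k.-2 yF bal a b ab).
  split; rewrite ?ek ?ya ?yb // => r rk; rewrite !addSn -!addnS D1 //; lia.
- apply: (no_unbalanced_pair y k.-2 yF bal b a ab).
  split; rewrite ?ek ?ya ?yb // => r rk; rewrite !addSn -!addnS D1 //; lia.
- by move: ya; rewrite ab yb.
Qed.

Lemma Y_balanced y : Y F y -> balanced y.
Proof.
move=> yF u v [i eu] [j ev] e.
have ev' : v = window y j (size u) by rewrite e.
have := Y_window_balanced _ yF (size u) i j.
have := Y_window_balanced _ yF (size u) j i.
rewrite -ev' /window -eu; lia.
Qed.

Theorem theorem5p10 : Y F = [set y : infinite_word | balanced y].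
Proof.
apply/seteqP; split => y; first exact: Y_balanced.
exact: balanced_Y.
Qed.
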